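(* Let $k,t$ be integers with $k\geq 5$ and $k=t$, and let $H$ be a non-empty graph of order $t$ that is not a complete graph. Then $$\operatorname{gr}_k(P_5:H)=t+1 .$$
   Context: All graphs are finite, simple and undirected; a graph is non-empty if it has at least one edge; the order of a graph is its number of vertices. $K_n$ is the complete graph on $n$ vertices and $P_5$ is the path with $5$ vertices and $4$ edges. A $k$-edge-coloring assigns to each edge one of $k$ colors; all $k$-edge-colorings are assumed exact, i.e. each of the $k$ colors is used at least once. An edge-colored graph is rainbow if all its edges have different colors and monochromatic if all its edges have a single color. A copy of a graph means a (not necessarily induced) subgraph isomorphic to it. For non-empty graphs $G,H$ and a positive integer $k$, the Gallai-Ramsey number $\operatorname{gr}_k(G:H)$ is the minimum integer $N$ with $\binom{N}{2}\geq k$ (so that $K_N$ admits a $k$-edge-coloring) such that for all $n\geq N$, every $k$-edge-coloring of $K_n$ contains either a rainbow copy of $G$ or a monochromatic copy of $H$.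
   Formalization: The formal theorem additionally assumes that H has no isolated vertices; without this the claim fails, e.g. for k=t=5 and H one edge plus three isolated vertices, where gr_5(P_5:H) ≤ 5. *)

(* Defs.v *)
From mathcomp Require Import all_boot.
Set Implicit Arguments.
Unset Strict Implicit.
Unset Printing Implicit Defensive.

Record sgraph := SGraph {
  vertex :> finType;
  adj : rel vertex;
  adj_sym : symmetric adj;
  adj_irrefl : irreflexive adj }.

Definition edges (G : sgraph) : {set {set G}} :=
  [set e | [exists x, exists y, adj x y && (e == [set x; y])]].

Definition nonempty (G : sgraph) : Prop := edges G != set0.

Definition is_complete (G : sgraph) : Prop :=
  forall x y : G, x != y -> adj x y.

Definition no_isolated_vertex (G : sgraph) : Prop :=
  forall x : G, exists y : G, adj x y.

Lemma complete_sym (n : nat) : symmetric (fun x y : 'I_n => x != y).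
Proof. by move=> x y; rewrite eq_sym. Qed.

Lemma complete_irrefl (n : nat) : irreflexive (fun x y : 'I_n => x != y).
Proof. by move=> x; rewrite eqxx. Qed.

Definition complete_graph (n : nat) : sgraph :=
  SGraph (@complete_sym n) (@complete_irrefl n).

Definition path_adj (n : nat) : rel 'I_n :=
  fun x y => (x.+1 == y :> nat) || (y.+1 == x :> nat).

Lemma path_sym (n : nat) : symmetric (@path_adj n).
Proof. by move=> x y; rewrite /path_adj orbC. Qed.

Lemma path_irrefl (n : nat) : irreflexive (@path_adj n).
Proof. by move=> x; rewrite /path_adj orbb; apply/eqP/nesym/n_Sn. Qed.

(* The index is the number of vertices. *)
Definition path_graph (n : nat) : sgraph :=
  SGraph (@path_sym n) (@path_irrefl n).

(* Colours are assigned to all vertex sets, but only the values on [edges F]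
   are ever used. *)
Definition coloring (k : nat) (F : sgraph) := {set F} -> 'I_k.

Definition exact_coloring (k : nat) (F : sgraph) (c : coloring k F) : Prop :=
  forall i : 'I_k, exists2 e, e \in edges F & c e = i.

(* The image of such an [f] is a copy of G in F, i.e. a not necessarily induced
   subgraph; the edge e of G corresponds to the edge [f @: e] of F. *)
Definition embedding (G F : sgraph) (f : G -> F) : Prop :=
  injective f /\ forall x y : G, adj x y -> adj (f x) (f y).

Definition has_rainbow_copy (k : nat) (F : sgraph) (c : coloring k F)
    (G : sgraph) : Prop :=
  exists2 f : G -> F, embedding f &
    {in edges G &, injective (fun e : {set G} => c (f @: e))}.

Definition has_monochromatic_copy (k : nat) (F : sgraph) (c : coloring k F)
    (H : sgraph) : Prop :=
  exists2 f : H -> F, embedding f &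
    exists i : 'I_k, {in edges H, forall e : {set H}, c (f @: e) = i}.

Definition gr_bound (k : nat) (G H : sgraph) (N : nat) : Prop :=
  k <= 'C(N, 2) /\
  forall n, N <= n -> forall c : coloring k (complete_graph n), exact_coloring c ->
    has_rainbow_copy c G \/ has_monochromatic_copy c H.

(* [gallai_ramsey k G H N] reads gr_k(G : H) = N, the existence of the minimum
   being part of the assertion. *)
Definition gallai_ramsey (k : nat) (G H : sgraph) (N : nat) : Prop :=
  gr_bound k G H N /\ forall M, gr_bound k G H M -> N <= M.

(* Main.v *)
Require Import Defs.
From mathcomp Require Import all_boot perm.

(* Let c be an exact k-coloring of K_n, n > k >= 5, without rainbow P_5.
   - If some vertex v sees at least three colours, then paths with v as an inner
     vertex show that v misses at most one colour, hence sees at least four, and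
     then that all edges off v have the same colour; K_n - v contains H.
   - Otherwise every vertex sees at most two colours. The sets of colours seen by
     x and by y share the colour of xy, so these sets of size at most two form an
     intersecting family; it covers more than three colours, so all of them
     contain one colour i. Edges of different colours other than i are thus
     disjoint, and the ends of such edges carry a copy of H in colour i.
   For the lower bound, colour the edges at one vertex of K_k with k - 1 different
   colours and all other edges with the remaining colour: each edge at the centre
   is alone in its colour, so a spanning monochromatic H would have an isolated
   vertex. *)

Set Implicit Arguments.
Unset Strict Implicit.
Unset Printing Implicit Defensive.

Lemma exists_notin (T : finType) (s : seq T) :
  size s < #|T| -> exists x, x \notin s.
Proof.
move=> hs; apply/existsP; rewrite -negb_forall; apply: contraL hs => /forallP h.
rewrite -leqNgt; apply: leq_trans (card_size s).
by apply: subset_leq_card; apply/subsetP => x _; exact: h.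
Qed.

(** * Edge-colorings without a rainbow path on five vertices *)

Section Structure.
Variables (T C : finType) (c : T -> T -> C).
Hypothesis c_sym : forall x y, c x y = c y x.
Hypothesis no_rainbow_P5 : forall x1 x2 x3 x4 x5,
  uniq [:: x1; x2; x3; x4; x5] ->
  ~~ uniq [:: c x1 x2; c x2 x3; c x3 x4; c x4 x5].

Lemma P5_cases x1 x2 x3 x4 x5 :
    x1 <> x2 -> x1 <> x3 -> x1 <> x4 -> x1 <> x5 -> x2 <> x3 -> x2 <> x4 ->
    x2 <> x5 -> x3 <> x4 -> x3 <> x5 -> x4 <> x5 ->
  [\/ c x1 x2 = c x2 x3, c x1 x2 = c x3 x4, c x1 x2 = c x4 x5 |
   [\/ c x2 x3 = c x3 x4, c x2 x3 = c x4 x5 | c x3 x4 = c x4 x5]].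
Proof.
do 10![move/eqP/negPf => ?].
have := @no_rainbow_P5 x1 x2 x3 x4 x5; rewrite /= !inE.
do 10![match goal with H : (_ == _) = false |- _ => rewrite {}H end].
move=> /(_ isT); do 6![case: eqP => ? //=; try by firstorder].
Qed.

(* Splits on which two edges of the path [a b d e f] share a colour and closes
   the cases that contradict the known (dis)equalities of colours. *)
Ltac p5 a b d e f :=
  have [[? ?] [? ?]] := ((c_sym a b, c_sym b d), (c_sym d e, c_sym e f));
  case: (@P5_cases a b d e f ltac:(congruence) ltac:(congruence)
    ltac:(congruence) ltac:(congruence) ltac:(congruence) ltac:(congruence)
    ltac:(congruence) ltac:(congruence) ltac:(congruence) ltac:(congruence));
  [move=> ?|move=> ?|move=> ?|case=> ?]; try congruence.

Ltac notin :=
  rewrite ?inE ?negb_or; repeat (case/andP => /eqP ?); move/eqP => ?.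

(** At least [m] colors at [v], in the form in which they are used: some edge at [v] avoids any
    shorter list of colors. *)
Definition sees_colors (v : T) (m : nat) :=
  forall s : seq C, size s < m -> exists2 u, u <> v & c v u \notin s.

Definition misses_color (v : T) (i : C) := forall u, u <> v -> c v u <> i.

(** * A vertex that sees at least three colors *)

(** Otherwise the paths [y z w v u] and [w z y v u] give every further edge [v u] the color of both
    [v w] and [v y], leaving two colors at [v]. *)
Lemma missed_adjacent_eq v y z w : sees_colors v 3 -> 4 < #|T| ->
    misses_color v (c y z) -> misses_color v (c z w) ->
    y <> v -> z <> v -> w <> v -> y <> z -> z <> w -> y <> w ->
  c y z = c z w.
Proof.
move=> hv hT m1 m2 yv zv wv yz zw yw; apply/eqP/negPn/negP => /eqP ne.
have outside u : u <> v -> u <> y -> u <> z -> u <> w ->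
    c v u = c v w /\ c v u = c v y.
  move=> uv uy uz uw.
  have [? ?] := (m1 _ uv, m2 _ uv); have [? ?] := (m1 _ yv, m2 _ yv).
  have [? ?] := (m1 _ wv, m2 _ wv).
  by split; [p5 y z w v u | p5 w z y v u].
have [u0] := @exists_notin T [:: v; y; z; w] hT.
notin.
have h0 := outside u0 ltac:(congruence) ltac:(congruence) ltac:(congruence)
  ltac:(congruence).
have [u uv] := hv [:: c v w; c v z] isT; notin.
have [e|/eqP uy] := eqVneq u y; first by case: h0; congruence.
by case: (outside u); congruence.
Qed.

(** Otherwise paths through [v] from one edge to the other give the four edges from [v] to their
    ends one color. Edges [v u] and [v u'] in two more colors then force [u y z w x] to be
    rainbow. *)
Lemma missed_disjoint_eq v y z w x : sees_colors v 3 ->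
    misses_color v (c y z) -> misses_color v (c w x) ->
    y <> v -> z <> v -> w <> v -> x <> v ->
    y <> z -> y <> w -> y <> x -> z <> w -> z <> x -> w <> x ->
  c y z = c w x.
Proof.
move=> hv m1 m2 yv zv wv xv yz yw yx zw zx wx; apply/eqP/negPn/negP => /eqP ne.
have [? ?] := (m1 _ yv, m2 _ yv); have [? ?] := (m1 _ zv, m2 _ zv).
have [? ?] := (m1 _ wv, m2 _ wv); have [? ?] := (m1 _ xv, m2 _ xv).
have e1 : c v z = c v w by p5 y z v w x.
have e2 : c v y = c v w by p5 z y v w x.
have e3 : c v z = c v x by p5 y z v x w.
have [u uv] := hv [:: c v y] isT; notin.
have [u' u'v] := hv [:: c v y; c v u] isT; notin.
have [? ?] := (m1 _ uv, m2 _ uv); have [? ?] := (m1 _ u'v, m2 _ u'v).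
clear m1 m2.
have zw1 : c z w = c v y by p5 u v y z w; p5 u v x w z; p5 u' v y z w; p5 u' v x w z.
have yw1 : c y w = c v y by p5 u v z y w; p5 u v x w y; p5 u' v z y w; p5 u' v x w y.
have uz : c u z = c v u by p5 y z u v u'; p5 x w z u v.
have uy : c u y = c v u by p5 z y u v u'; p5 x w y u v.
by p5 u y z w x.
Qed.

Lemma missed_adjacent_spokes v y z w : sees_colors v 4 -> 5 < #|T| ->
    misses_color v (c y z) ->
    y <> v -> z <> v -> w <> v -> y <> z -> z <> w -> y <> w ->
    c y z <> c z w ->
  c v w = c z w /\ c v y = c z w.
Proof.
move=> hv hT m yv zv wv yz zw yw ne.
have ? := m _ yv; have ? := m _ zv; have ? := m _ wv.
have wz : c v w = c z w.
  apply/eqP/negPn/negP => /eqP nw.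
  have outside u : u <> v -> u <> y -> u <> z -> u <> w -> c v u <> c z w ->
      c v u = c v w.
    by move=> uv *; have ? := m _ uv; p5 y z w v u.
  have [u uv] := hv [:: c z w; c v w; c v z] isT; notin.
  have [e|/eqP uy] := eqVneq u y; last by have := outside u; intuition congruence.
  subst u.
  have outsideE u : u <> v -> u <> y -> u <> z -> u <> w -> c v u = c z w.
    move=> uv' *; apply/eqP/negPn/negP => /eqP nu.
    have ? : c v u = c v w by apply: outside.
    by have ? := m _ uv'; clear outside m; p5 w z y v u.
  have [u] := hv [:: c z w; c v w; c v y] isT => ?; notin.
  have [e|/eqP uz] := eqVneq u z; last first.
    by have := outsideE u; intuition congruence.
  subst u.
  (* Now [v w], [v y], [v z] and [z w] have four different colors, and every further vertex is
     joined to [v] in the color of [z w]; two such vertices are needed. *)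
  have [u] := @exists_notin T [:: v; y; z; w] (ltnW hT); notin.
  have [u'] := @exists_notin T [:: v; y; z; w; u] hT; notin.
  have ? : c v u = c z w by apply: outsideE.
  have ? : c v u' = c z w by apply: outsideE.
  clear outside outsideE m.
  have ? : c y u = c v w by p5 z w v y u; p5 u y z v w.
  by p5 y z v u u'; p5 z y v u u'; p5 u' u y v z.
split=> //; apply/eqP/negPn/negP => /eqP ny.
have [u uv] := hv [:: c z w; c v y; c v z] isT; notin.
have ? := m _ uv; clear m; p5 w z y v u.
Qed.

(** Otherwise [v y] and [v w] have the color of [z w]. For an edge [v u] in a new color, replacing
    [y] or [w] by [u], according to the color of [z u], gives [v u] that color too. *)
Lemma missed_adjacent v y z w : sees_colors v 4 -> 5 < #|T| ->
    misses_color v (c y z) ->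
    y <> v -> z <> v -> w <> v -> y <> z -> z <> w -> y <> w ->
  c y z = c z w.
Proof.
move=> hv hT m yv zv wv yz zw yw; apply/eqP/negPn/negP => /eqP ne.
have [ew ey] := missed_adjacent_spokes hv hT m yv zv wv yz zw yw ne.
have [u uv] := hv [:: c z w; c v z] isT; notin.
have [u' u'v] := hv [:: c z w; c v z; c v u] isT; notin.
have ? := m _ uv; have ? := m _ u'v.
have [e|/eqP ne'] := eqVneq (c z u) (c y z).
  have ue : c u z = c y z by rewrite c_sym.
  have mu : misses_color v (c u z) by rewrite ue.
  by case: (missed_adjacent_spokes (w := w) hv hT mu); congruence.
by case: (missed_adjacent_spokes (w := u) hv hT m); congruence.
Qed.

(** If [v w] had a third color, the paths [y z w v u] would confine all edges at [v] except [v y]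
    and [v z] to three colors. Hence [v y] and [v z] bring the fourth and fifth, and [u w z v y] is
    rainbow for some [u]. *)
Lemma full_adjacent_spoke v y z w : sees_colors v 5 ->
    y <> v -> z <> v -> w <> v -> y <> z -> z <> w -> y <> w ->
    c y z <> c z w ->
  c v w = c y z \/ c v w = c z w.
Proof.
move=> hv yv zv wv yz zw yw ne.
have [|/eqP n1] := eqVneq (c v w) (c y z); first by left.
have [|/eqP n2] := eqVneq (c v w) (c z w); first by right.
have [u uv] := hv [:: c y z; c z w; c v w; c v z] isT; notin.
have [e|/eqP uy] := eqVneq u y; last by p5 y z w v u.
subst u.
have [u ?] := hv [:: c y z; c z w; c v w; c v y] isT; notin.
have [e|/eqP uz] := eqVneq u z; last by p5 y z w v u.
subst u.
have [u ?] := hv [:: c z w; c v w; c v y; c v z] isT; notin.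
have ? : c v u = c y z by p5 y z w v u.
have [e|/eqP e] := eqVneq (c w u) (c v w).
  by p5 u w z v y.
have ? : c w u = c y z by p5 z y v w u; p5 y z v w u.
by p5 u w z v y.
Qed.

Lemma full_adjacent v y z w : sees_colors v 5 ->
    y <> v -> z <> v -> w <> v -> y <> z -> z <> w -> y <> w ->
  c y z = c z w.
Proof.
move=> hv yv zv wv yz zw yw; apply/eqP/negPn/negP => /eqP ne.
have sw a b d : a <> v -> b <> v -> d <> v -> a <> b -> b <> d -> a <> d ->
  c a b <> c b d -> c v d = c a b \/ c v d = c b d by apply: full_adjacent_spoke.
have ? := (c_sym y z); have ? := c_sym z w.
have hw : c v w = c y z \/ c v w = c z w by apply: sw.
have hy : c v y = c y z \/ c v y = c z w by have := sw w z y; intuition congruence.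
have [u uv] := hv [:: c y z; c z w; c v z] isT; notin.
have [u' u'v] := hv [:: c y z; c z w; c v z; c v u] isT; notin.
have [uy uw] : u <> y /\ u <> w by intuition congruence.
have [u'y u'w] : u' <> y /\ u' <> w by intuition congruence.
have [uz u'z] : u <> z /\ u' <> z by intuition congruence.
have uu' : u <> u' by congruence.
have ? := c_sym u z.
have zu : c z u = c v u.
  have [e|/eqP ?] := eqVneq (c z u) (c y z).
    by case: (sw w z u); congruence.
  by case: (sw y z u); congruence.
have {}hy : c v y = c y z.
  by case: hy => // hy; case: (sw u z y); congruence.
have {}hw : c v w = c z w.
  by case: hw => // hw; case: (sw u z w); congruence.
have h1 : c y w = c y z \/ c y w = c z w.
  have [|/eqP ?] := eqVneq (c y w) (c y z); first by left.
  by case: (sw z y w); intuition congruence.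
have h2 : c u u' = c v u \/ c u u' = c v u'.
  have [|/eqP ?] := eqVneq (c u u') (c v u); first by left.
  by case: (sw z u u'); intuition congruence.
clear sw hv.
(* Each path is ordered so that its edges take the colors of [y z], [z w], [v u] and [v u'], once
   each. *)
case: h1 => h1; case: h2 => h2.
- by p5 y w v u' u.
- by p5 y w v u u'.
- by p5 w y v u' u.
- by p5 w y v u u'.
Qed.

(** Steps between adjacent edges lead from [p q] to every edge off [v]. *)
Lemma off_vertex_monochromatic v p q : p <> v -> q <> v -> p <> q ->
    (forall y z w, y <> v -> z <> v -> w <> v -> y <> z -> z <> w -> y <> w ->
      c y z = c p q -> c z w = c p q) ->
  forall x y, x <> v -> y <> v -> x <> y -> c x y = c p q.
Proof.
move=> pv qv pq h x y xv yv xy.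
have [e|/eqP xp] := eqVneq x p.
  have [e'|/eqP yq] := eqVneq y q; first by rewrite e e'.
  by rewrite e; apply: (h q); rewrite 1?c_sym; congruence.
have [e|/eqP xq] := eqVneq x q.
  have [e'|/eqP yp] := eqVneq y p; first by rewrite e e' c_sym.
  by rewrite e; apply: (h p); congruence.
have qx : c q x = c p q by apply: (h p); congruence.
have [->|/eqP yq] := eqVneq y q; first by rewrite c_sym.
by apply: (h q); congruence.
Qed.

Hypothesis c_onto : forall i, exists x y, x <> y /\ c x y = i.
Hypothesis T_ge6 : 5 < #|T|.
Hypothesis C_ge5 : 4 < #|C|.

Lemma missed_unique v i j : sees_colors v 3 ->
  misses_color v i -> misses_color v j -> i = j.
Proof.
move=> hv mi mj.
have [y [z [yz yzi]]] := c_onto i; have [w [x [wx wxj]]] := c_onto j.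
have off u u' : u <> u' -> c u u' = i \/ c u u' = j -> u <> v /\ u' <> v.
  move=> uu' h; split=> e; subst.
    by case: h; [apply: mi|apply: mj]; congruence.
  by case: h; rewrite c_sym; [apply: mi|apply: mj]; congruence.
have adj a b d : a <> b -> b <> d -> c a b = i -> c b d = j -> i = j.
  move=> ab bd abi bdj; have [e|/eqP ad] := eqVneq a d.
    by rewrite -abi -bdj e c_sym.
  have [? ?] := off a b ab (or_introl abi).
  have [? ?] := off b d bd (or_intror bdj).
  rewrite -abi -bdj; apply: (@missed_adjacent_eq v); rewrite ?abi ?bdj //.
  exact: ltnW.
have [? ?] := off y z yz (or_introl yzi).
have [? ?] := off w x wx (or_intror wxj).
have ? := c_sym y z; have ? := c_sym w x.
have [e|/eqP zw] := eqVneq z w; first by apply: (adj y z x); congruence.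
have [e|/eqP zx] := eqVneq z x; first by apply: (adj y z w); congruence.
have [e|/eqP yw] := eqVneq y w; first by apply: (adj z y x); congruence.
have [e|/eqP yx] := eqVneq y x; first by apply: (adj z y w); congruence.
rewrite -yzi -wxj; apply: (@missed_disjoint_eq v); rewrite ?yzi ?wxj //.
Qed.

Lemma star_structure v : sees_colors v 3 ->
  exists i, forall x y, x <> v -> y <> v -> x <> y -> c x y = i.
Proof.
move=> hv.
have [/existsP[i /forallP mi]|] :=
    boolP [exists i, [forall u, (u != v) ==> (c v u != i)]].
  have {}mi : misses_color v i by move=> u /eqP uv; have /implyP/(_ uv)/eqP := mi u.
  have hv4 : sees_colors v 4.
    (* Some color lies outside [s] and differs from [i]; as [i] is the only missed color, [v] sees
       it. *)
    move=> s hs; have [|j] := @exists_notin C (i :: s).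
      exact: leq_ltn_trans C_ge5.
    rewrite inE negb_or => /andP[/eqP ji js].
    have [/existsP[u /andP[/eqP ? /eqP e]]|] :=
        boolP [exists u, (u != v) && (c v u == j)].
      by exists u => //; rewrite e.
    rewrite negb_exists => /forallP mj; case: ji; apply: (@missed_unique v) => //.
    by move=> u /eqP uv e; have := mj u; rewrite uv e eqxx.
  have [p [q [pq e]]] := c_onto i; exists i; subst i.
  apply: off_vertex_monochromatic => //.
  - by move=> e; subst; apply: (mi q); congruence.
  - by move=> e; subst; apply: (mi p); rewrite 1?c_sym; congruence.
  - move=> y z w ? ? ? ? ? ? yz; rewrite -yz; symmetry.
    by apply: (@missed_adjacent v); rewrite ?yz.
rewrite negb_exists => /forallP sees.
have hv5 : sees_colors v 5.
  move=> s hs; have [|j js] := @exists_notin C s; first exact: leq_ltn_trans C_ge5.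
  have := sees j; rewrite negb_forall => /existsP[u].
  by rewrite negb_imply negbK => /andP[/eqP ? /eqP e]; exists u; rewrite ?e.
have [p] := @exists_notin T [:: v] (leq_trans (isT : 1 < 6) T_ge6); notin.
have [q] := @exists_notin T [:: v; p] (leq_trans (isT : 2 < 6) T_ge6); notin.
exists (c p q); apply: off_vertex_monochromatic; try congruence.
by move=> y z w *; have := @full_adjacent v y z w; intuition congruence.
Qed.

(** * Colorings with at most two colors at every vertex *)

Lemma dominant_structure :
    (forall v a b d, a <> v -> b <> v -> d <> v ->
      [\/ c v a = c v b, c v a = c v d | c v b = c v d]) ->
  exists i, forall v a b, a <> v -> b <> v -> c v a <> i -> c v b <> i ->
    c v a = c v b.
Proof.
move=> two.
have [x [a [b [ax [bx ab]]]]] : exists x a b, a <> x /\ b <> x /\ c x a <> c x b.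
  have [i _] := @exists_notin C [::] (ltn_trans (isT : 0 < 4) C_ge5).
  have [j] := @exists_notin C [:: i] (ltn_trans (isT : 1 < 4) C_ge5); notin.
  have [a [b [ab abi]]] := c_onto i; have [d [e [de dej]]] := c_onto j.
  have [E|/eqP ad] := eqVneq a d; first by exists a, b, e; split; [|split]; congruence.
  have [E|/eqP ?] := eqVneq (c a d) i.
    by exists d, a, e; split; [|split]; rewrite 1?(c_sym d a); congruence.
  by exists a, b, d; split; [|split]; congruence.
(* Edges in two further colors avoid [x], which already sees two; the dominant color will be that of
   [x y]. *)
have [i3] := @exists_notin C [:: c x a; c x b] (ltn_trans (isT : 2 < 4) C_ge5); notin.
have [i4] := @exists_notin C [:: c x a; c x b; i3]
  (ltn_trans (isT : 3 < 4) C_ge5); notin.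
have [y [z [yz e3]]] := c_onto i3; have [w [t [wt e4]]] := c_onto i4.
have off p q j : p <> q -> c p q = j -> j <> c x a -> j <> c x b ->
    p <> x /\ q <> x.
  move=> pq pqj ja jb; have [? ?] := (c_sym p q, c_sym x p).
  split=> e; subst.
    by case: (two x a b q); congruence.
  by case: (two x a b p); congruence.
have [? ?] := off y z i3 ltac:(congruence) e3 ltac:(congruence) ltac:(congruence).
have [? ?] := off w t i4 ltac:(congruence) e4 ltac:(congruence) ltac:(congruence).
have ? := c_sym x y; have ? := c_sym x w; have ? := c_sym y w.
have xy : c x y = c x a \/ c x y = c x b.
  by case: (two x a b y); try congruence; intuition.
have xw : c x w = c x a \/ c x w = c x b.
  by case: (two x a b w); try congruence; intuition.
(* Otherwise [y] and [w] would see disjoint sets of colors, yet both see the color of [y w]. *)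
have xyw : c x y = c x w.
  apply/eqP/negPn/negP => /eqP ne.
  have [e|/eqP yw] := eqVneq y w; first by congruence.
  case: (two y x z w); try congruence; case: (two w x t y); intuition congruence.
have [i2 [i2x [b' [bx' b'i2]]]] : exists i2, i2 <> c x y /\
   exists b', b' <> x /\ c x b' = i2 /\ i3 <> i2 /\ i4 <> i2.
  by case: xy => ->; [exists (c x b) | exists (c x a)]; split; try congruence;
    [exists b | exists a]; intuition congruence.
exists (c x y) => v p q pv qv np nq.
have ? := c_sym v x; have ? := c_sym v y; have ? := c_sym v w.
(* Besides the dominant color, [x], [y] and [w] see [i2], [i3] and [i4] respectively; a vertex not
   seeing the dominant color would see all three of these. *)
have [r [rv vr]] : exists r, r <> v /\ c v r = c x y.
  have [e|/eqP vx] := eqVneq v x; first by exists y; intuition congruence.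
  have [e|/eqP vy] := eqVneq v y; first by exists x; intuition congruence.
  have [e|/eqP vw] := eqVneq v w; first by exists x; intuition congruence.
  have [e1|/eqP n1] := eqVneq (c v x) (c x y); first by exists x; intuition congruence.
  have [e1|/eqP n2] := eqVneq (c v y) (c x y); first by exists y; intuition congruence.
  have [e1|/eqP n5] := eqVneq (c v w) (c x y); first by exists w; intuition congruence.
  have ? : c x v = i2 by case: (two x y b' v); intuition congruence.
  have ? : c y v = i3 by case: (two y x z v); intuition congruence.
  have ? : c w v = i4 by case: (two w x t v); intuition congruence.
  by case: (two v x y w); intuition congruence.
by case: (two v p q r); congruence.
Qed.

Lemma coloring_structure :
  (exists v i, forall x y, x <> v -> y <> v -> x <> y -> c x y = i) \/
  exists i, forall v a b, a <> v -> b <> v -> c v a <> i -> c v b <> i ->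
    c v a = c v b.
Proof.
have [/existsP[v /existsP[a /existsP[b /existsP[d]]]]|] := boolP
    [exists v, exists a, exists b, exists d,
      [&& a != v, b != v, d != v & uniq [:: c v a; c v b; c v d]]].
  case/and4P=> /eqP av /eqP bv /eqP dv un; left; exists v; apply: star_structure.
  move=> s hs; have [sa|na] := boolP (c v a \in s); last by exists a.
  have [sb|nb] := boolP (c v b \in s); last by exists b.
  have [sd|nd] := boolP (c v d \in s); last by exists d.
  have /(uniq_leq_size un) : {subset [:: c v a; c v b; c v d] <= s}.
    by apply/allP; rewrite /= sa sb sd.
  by rewrite leqNgt hs.
move=> h; right; apply: dominant_structure => v a b d /eqP av /eqP bv /eqP dv.
have : ~~ uniq [:: c v a; c v b; c v d].
  apply: contra h => un; apply/existsP; exists v; apply/existsP; exists a.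
  apply/existsP; exists b; apply/existsP; exists d; exact/and4P.
rewrite /= !inE.
case: eqP => [? _|_ /=]; first by constructor 1.
case: eqP => [? _|_ /=]; first by constructor 2.
by case: eqP => // ? _; constructor 3.
Qed.

End Structure.

(** * Copies of graphs in a colored complete graph *)

Lemma edgesP (G : sgraph) (e : {set G}) :
  reflect (exists x y, adj x y /\ e = [set x; y]) (e \in edges G).
Proof.
rewrite inE; apply: (iffP existsP).
  by case=> x /existsP[y /andP[xy /eqP ->]]; exists x, y.
by case=> x [y [xy ->]]; exists x; apply/existsP; exists y; rewrite xy eqxx.
Qed.

Lemma imset_pair (A B : finType) (f : A -> B) x y :
  f @: [set x; y] = [set f x; f y].
Proof. by rewrite imsetU1 imset_set1. Qed.

Lemma monochromatic_copyI n k (c : coloring k (complete_graph n)) (H : sgraph)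
    (f : H -> complete_graph n) i :
    injective f -> (forall x y, adj x y -> c [set f x; f y] = i) ->
  has_monochromatic_copy c H.
Proof.
move=> f_inj fc; exists f; last first.
  by exists i => _ /edgesP[x [y [xy ->]]]; rewrite imset_pair fc.
split=> // x y xy; rewrite /= (inj_eq f_inj).
by apply: contraTneq xy => ->; rewrite adj_irrefl.
Qed.

Lemma rainbow_P5I n k (c : coloring k (complete_graph n)) x1 x2 x3 x4 x5 :
    uniq [:: x1; x2; x3; x4; x5] ->
    uniq [:: c [set x1; x2]; c [set x2; x3]; c [set x3; x4]; c [set x4; x5]] ->
  has_rainbow_copy c (path_graph 5).
Proof.
set xs := [:: x1; _; _; _; _] => ux uc.
pose f (i : path_graph 5) := nth x1 xs i.
have f_inj : injective f.
  move=> i j /eqP; rewrite nth_uniq ?ltn_ord // => /eqP ij; exact: val_inj.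
exists f.
  split=> // x y xy; rewrite /= (inj_eq f_inj).
  by apply: contraTneq xy => ->; rewrite adj_irrefl.
pose edge j : {set path_graph 5} := [set inord j; inord j.+1].
set cs := [:: _; _; _; _] in uc.
(* Edges of the path are numbered by their lower end, in the order of [cs]. *)
have edgeE e : e \in edges (path_graph 5) ->
    exists2 j, j < 4 & e = edge j /\ c (f @: e) = nth (c [set x1; x2]) cs j.
  have key (x y : 'I_5) : x.+1 = y ->
    exists2 j, j < 4 & [set x; y] = edge j /\
      c (f @: [set x; y]) = nth (c [set x1; x2]) cs j.
    move=> xy; exists x; first by have := ltn_ord y; rewrite -xy ltnS.
    have ye : inord x.+1 = y by apply: ord_inj; rewrite inordK xy.
    rewrite /edge inord_val ye imset_pair; split=> //.
    rewrite /f -xy; have := ltn_ord y; rewrite -xy ltnS.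
    by case: x {xy ye} => -[|[|[|[|]]]].
  case/edgesP=> x [y [/orP[/eqP xy|/eqP yx] ->]]; first exact: key.
  by rewrite setUC; apply: key.
move=> e e' /edgeE[j j4 [ej cj]] /edgeE[j' j'4 [ej' cj']].
by rewrite cj cj' ej ej' => /eqP; rewrite nth_uniq // => /eqP ->.
Qed.

Lemma star_copy n k (c : coloring k (complete_graph n)) (H : sgraph) v i :
    #|H| < n ->
    (forall x y, x <> v -> y <> v -> x <> y -> c [set x; y] = i) ->
  has_monochromatic_copy c H.
Proof.
case: n => [|n] in c v * => // hn hc.
pose f (h : H) := lift v (widen_ord (hn : #|H| <= n) (enum_rank h)).
have f_inj : injective f.
  by move=> h h' /lift_inj/(congr1 val)/= e; apply: enum_rank_inj; apply: ord_inj.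
apply: (@monochromatic_copyI _ _ _ _ f i) => // x y xy.
apply: hc; try by apply/nesym/eqP/neq_lift.
by move/f_inj=> e; rewrite e adj_irrefl in xy.
Qed.

(* Two nonadjacent vertices of [H] are sent to the ends of one edge of a
   non-dominant colour; the other vertices are sent to ends of edges of the
   remaining non-dominant colours, one for each. *)
Lemma dominant_copy n k (c : coloring k (complete_graph n)) (H : sgraph) i :
    exact_coloring c -> #|H| = k -> ~ is_complete H ->
    (forall v a b, a <> v -> b <> v -> c [set v; a] <> i -> c [set v; b] <> i ->
      c [set v; a] = c [set v; b]) ->
  has_monochromatic_copy c H.
Proof.
move=> c_exact Hk Hnc dom.
have [x [y [xy nxy]]] : exists x y : H, x <> y /\ ~~ adj x y.
  have [/existsP[x /existsP[y /andP[/eqP ? ?]]]|] :=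
      boolP [exists x : H, exists y : H, (x != y) && ~~ adj x y].
    by exists x, y.
  move=> h; case: Hnc => x y xy; apply: contraNT h => nxy.
  by apply/existsP; exists x; apply/existsP; exists y; rewrite xy.
have ends j : exists pq : 'I_n * 'I_n, (pq.1 != pq.2) && (c [set pq.1; pq.2] == j).
  have [e /edgesP[p [q [pq ->]]] cj] := c_exact j.
  by exists (p, q); apply/andP; split; [exact: pq | apply/eqP].
pose P j := xchoose (ends j).
have PP j : (P j).1 <> (P j).2 /\ c [set (P j).1; (P j).2] = j.
  by have /andP[/eqP ? /eqP ?] := xchooseP (ends j).
pose r (h : H) : 'I_k := cast_ord Hk (enum_rank h).
(* The transposition hands the dominant color to [y], so the other vertices receive the non-dominant
   colors, one each. *)
pose g h := tperm (r y) i (r h).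
have g_inj : injective g by move=> h h' /perm_inj/cast_ord_inj/enum_rank_inj.
have gy : g y = i by rewrite /g tpermL.
pose col h := if h == y then g x else g h.
have col_ni h : col h <> i.
  rewrite /col; case: eqP => hy; rewrite -gy => /g_inj; first exact: xy.
  exact: hy.
pose f h := if h == y then (P (g x)).2 else (P (g h)).1.
have fP h : exists2 u, u <> f h & c [set f h; u] = col h.
  rewrite /f /col; case: eqP => _.
    by have [? ?] := PP (g x); exists (P (g x)).1 => //; rewrite setUC.
  by have [? ?] := PP (g h); exists (P (g h)).2 => //; apply: nesym.
have col_eq h h' : col h = col h' -> [\/ h = h', h = x /\ h' = y | h = y /\ h' = x].
  rewrite /col; case: eqP => [->|hy]; case: eqP => [->|h'y] /g_inj.
  - by constructor 1.
  - by move=> ->; constructor 3.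
  - by move=> ->; constructor 2.
  - by move=> ->; constructor 1.
have fxy : f x <> f y by rewrite /f eqxx; case: eqP => // _; case: (PP (g x)).
(* By [dom] a vertex sees only one non-dominant color, so equal images have equal [col]; only [x]
   and [y] share one, and their images are the two ends of an edge. *)
have f_inj : injective f.
  move=> h h' e; have [u uh cu] := fP h; have [u' uh' cu'] := fP h'.
  have : col h = col h'.
    rewrite -cu -cu' -e; apply: dom => //; rewrite ?cu ?e ?cu' //.
  by case/col_eq=> // -[e1 e2]; case: fxy; rewrite -e1 -e2.
(* An edge in another color would have both [col h] and [col h'] as its color, making [h] and [h']
   the nonadjacent pair. *)
apply: (monochromatic_copyI (f := f) (i := i)) => // h h' hh'.
apply/eqP/negPn/negP => /eqP ne.
have nh : h <> h' by move=> e; rewrite e adj_irrefl in hh'.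
have nf : f h <> f h' by move/f_inj.
have key a b : f a <> f b -> c [set f a; f b] <> i -> c [set f a; f b] = col a.
  move=> ab abi; have [u ua cu] := fP a; rewrite -cu; apply: dom => //.
    exact: nesym.
  by rewrite cu.
have : col h = col h'.
  rewrite -(key h h') // setUC; apply: key; first exact: nesym.
  by rewrite setUC.
case/col_eq=> // -[e1 e2]; move: nxy; rewrite -e1 -e2; first by rewrite hh'.
by rewrite adj_sym hh'.
Qed.

Lemma upper_bound n k (c : coloring k (complete_graph n)) (H : sgraph) :
    4 < k -> k < n -> #|H| = k -> ~ is_complete H -> exact_coloring c ->
  has_rainbow_copy c (path_graph 5) \/ has_monochromatic_copy c H.
Proof.
move=> k5 kn Hk Hnc c_exact.
pose cc (x y : 'I_n) := c [set x; y].
have [/existsP[x1 /existsP[x2 /existsP[x3 /existsP[x4 /existsP[x5 /andP[ux uc]]]]]]|] :=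
    boolP [exists x1, exists x2, exists x3, exists x4, exists x5,
      uniq [:: x1; x2; x3; x4; x5] &&
      uniq [:: cc x1 x2; cc x2 x3; cc x3 x4; cc x4 x5]].
  by left; apply: rainbow_P5I ux uc.
move=> no_rainbow; right.
have cc_sym x y : cc x y = cc y x by rewrite /cc setUC.
have cc_onto j : exists x y, x <> y /\ cc x y = j.
  have [e /edgesP[p [q [/eqP pq ->]]] cj] := c_exact j.
  by exists p, q.
have cc_free x1 x2 x3 x4 x5 : uniq [:: x1; x2; x3; x4; x5] ->
    ~~ uniq [:: cc x1 x2; cc x2 x3; cc x3 x4; cc x4 x5].
  move=> ux; apply: contra no_rainbow => uc.
  apply/existsP; exists x1; apply/existsP; exists x2; apply/existsP; exists x3.
  by apply/existsP; exists x4; apply/existsP; exists x5; rewrite ux uc.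
have [||[v [i hv]]|[i hi]] := @coloring_structure _ _ cc cc_sym cc_free cc_onto.
- by rewrite card_ord; apply: leq_ltn_trans kn.
- by rewrite card_ord.
- by apply: (@star_copy _ _ _ _ v i) => //; rewrite Hk.
- exact: (@dominant_copy _ _ _ _ i).
Qed.

(** * The star coloring and the lower bound *)

(** Colors are named after vertices, with [ord0] as the centre. The default in [odflt] is reached
    only at the singleton of [ord0], which is not an edge. *)
Definition star_coloring k : coloring k.+1 (complete_graph k.+1) :=
  fun e : {set 'I_k.+1} =>
    if ord0 \in e then odflt ord0 [pick x in e :\ ord0] else ord0.

Lemma star_coloring0 k (x : 'I_k.+1) : x != ord0 ->
  star_coloring [set ord0; x] = x.
Proof.
move=> x0; rewrite /star_coloring !inE eqxx /=.
case: pickP => [y|/(_ x)]; rewrite !inE.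
  by case/andP=> /negPf -> /eqP.
by rewrite x0 eqxx orbT.
Qed.

Lemma star_coloring_off k (x y : 'I_k.+1) : x != ord0 -> y != ord0 ->
  star_coloring [set x; y] = ord0.
Proof.
by move=> x0 y0; rewrite /star_coloring !inE !(eq_sym ord0) (negPf x0) (negPf y0).
Qed.

Lemma star_coloring_exact k : 1 < k -> exact_coloring (@star_coloring k).
Proof.
case: k => [|[|k]] // _ i; have [->|i0] := eqVneq i ord0.
  pose x : 'I_k.+3 := inord 1; pose y : 'I_k.+3 := inord 2.
  have [x1 y2] : x = 1 :> nat /\ y = 2 :> nat by rewrite !inordK.
  exists [set x; y]; last by rewrite star_coloring_off // -val_eqE /= ?x1 ?y2.
  by apply/edgesP; exists x, y; split=> //=; rewrite -val_eqE /= x1 y2.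
exists [set ord0; i]; last exact: star_coloring0.
by apply/edgesP; exists ord0, i; rewrite /= eq_sym.
Qed.

(** Wherever the centre lies, at least two of the four edges of the path avoid it, and these share
    the color [ord0]. *)
Lemma star_coloring_no_rainbow k : ~ has_rainbow_copy (@star_coloring k) (path_graph 5).
Proof.
case=> f [f_inj _] f_rainbow.
pose p j : path_graph 5 := @inord 4 j.
have pE j : j < 5 -> p j = j :> nat by move=> j5; rewrite inordK.
have edgeP j : j < 4 -> [set p j; p j.+1] \in edges (path_graph 5).
  move=> j4; apply/edgesP; exists (p j), (p j.+1); split=> //.
  by rewrite /= /path_adj !pE ?eqxx // ltnW.
have absurd i j : i < j -> j < 4 -> f (p i) != ord0 -> f (p i.+1) != ord0 ->
    f (p j) != ord0 -> f (p j.+1) != ord0 -> False.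
  move=> ij j4 i0 i1 j0 j1; have i4 := ltn_trans ij j4.
  have /setP/(_ (p i)) : [set p i; p i.+1] = [set p j; p j.+1].
    by apply: f_rainbow; rewrite ?edgeP // !imset_pair !star_coloring_off.
  rewrite !inE eqxx -!val_eqE /= (pE i (ltnW i4)) (pE j (ltnW j4)) (pE j.+1 j4).
  by rewrite !ltn_eqF // ltnS ltnW.
have others a b : a < 5 -> b < 5 -> a != b -> f (p a) = ord0 -> f (p b) != ord0.
  move=> a5 b5 ab <-; rewrite (inj_eq f_inj) -val_eqE /= !pE // eq_sym //.
have [e2|n2] := eqVneq (f (p 2)) ord0.
  by apply: (absurd 0 3) => //; apply: (others 2).
have [e1|n1] := eqVneq (f (p 1)) ord0.
  by apply: (absurd 2 3) => //; apply: (others 1).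
have [e3|n3] := eqVneq (f (p 3)) ord0.
  by apply: (absurd 0 1) => //; apply: (others 3).
exact: (absurd 1 2).
Qed.

(** The copy is spanning, so some [z] maps to the centre, and a neighbor [x] of [z] gives a copy in
    color [f x]. An edge at a third vertex would have another color. *)
Lemma star_coloring_no_monochromatic k (H : sgraph) :
    1 < k -> #|H| = k.+1 -> no_isolated_vertex H ->
  ~ has_monochromatic_copy (@star_coloring k) H.
Proof.
move=> k2 Hk Hiso [f [f_inj _] [i f_mono]].
have mono x y : adj x y -> star_coloring [set f x; f y] = i.
  by move=> xy; rewrite -imset_pair; apply: f_mono; apply/edgesP; exists x, y.
have [g fg gf] : bijective f by apply: inj_card_bij; rewrite ?card_ord ?Hk.
set z := g ord0; have fz : f z = ord0 by apply: gf.
have nz x : x <> z -> f x != ord0.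
  by move=> xz; apply/eqP => e; case: xz; apply: f_inj; rewrite fz.
have nadj x y : adj x y -> x <> y by move=> xy e; rewrite e adj_irrefl in xy.
have adjz x : adj z x -> f x = i.
  by move=> zx; rewrite -(mono z x zx) fz star_coloring0 //; apply/nz/nesym/nadj.
have [x zx] := Hiso z.
have xz : x <> z by apply/nesym/nadj.
have [|y] := @exists_notin H [:: z; x]; first by rewrite Hk ltnS.
rewrite !inE negb_or => /andP[/eqP yz /eqP yx].
have [w yw] := Hiso y.
have [e|/eqP wz] := eqVneq w z.
  by apply: yx; apply: f_inj; rewrite (adjz x) // (adjz y) // adj_sym -e.
have := mono y w yw; rewrite star_coloring_off ?nz // => i0.
by have := nz x xz; rewrite (adjz x zx) -i0 eqxx.
Qed.

Theorem theorem2p3 (k t : nat) (H : sgraph)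
    (hk : 5 <= k) (hkt : k = t)
    (H_nonempty : nonempty H) (H_order : #|H| = t)
    (H_not_complete : ~ is_complete H)
    (H_no_isolated : no_isolated_vertex H) :
  gallai_ramsey k (path_graph 5) H t.+1.
Proof.
subst t; split.
  split; first by rewrite binS bin1; apply: leq_addl.
  by move=> n kn c; apply: upper_bound.
move=> M [_ hM]; rewrite ltnNge; apply/negP => Mk.
(* After this shift [H] has order [k.+1], and a smaller bound [M] would apply to the star coloring
   on [k.+1] vertices. *)
case: k hk H_order hM Mk => // k k5 Hk hM Mk.
have k2 : 1 < k by apply: (@leq_trans 4).
have [] := hM _ Mk (@star_coloring k) (star_coloring_exact k2).
  exact: star_coloring_no_rainbow.
exact: star_coloring_no_monochromatic k2 Hk H_no_isolated.
Qed.
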